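(* Let $\mathbf{k}$ be a commutative ring with unit and $\Omega$ a semigroup. (1) Let $(D,\{\prec_\omega,\succ_\omega\mid\omega\in\Omega\})$ be a dendriform family algebra. Then $(D\otimes\mathbf{k}\Omega,\prec,\succ)$ is a dendriform algebra, where $\prec,\succ$ are the bilinear operations given by $$(x\otimes\alpha)\prec(y\otimes\beta):=(x\prec_\beta y)\otimes\alpha\beta,\qquad (x\otimes\alpha)\succ(y\otimes\beta):=(x\succ_\alpha y)\otimes\alpha\beta,$$ for $x,y\in D$ and $\alpha,\beta\in\Omega$. (2) Let $(T,\{\prec_\omega,\succ_\omega\mid\omega\in\Omega\},\cdot)$ be a tridendriform family algebra. Then $(T\otimes\mathbf{k}\Omega,\prec,\succ,\bullet)$ is a tridendriform algebra, where $\prec,\succ,\bullet$ are the bilinear operations given by $$(x\otimes\alpha)\prec(y\otimes\beta):=(x\prec_\beta y)\otimes\alpha\beta,\quad (x\otimes\alpha)\succ(y\otimes\beta):=(x\succ_\alpha y)\otimes\alpha\beta,\quad (x\otimes\alpha)\bullet(y\otimes\beta):=(x\cdot y)\otimes\alpha\beta,$$ for $x,y\in T$ and $\alpha,\beta\in\Omega$.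
   Context: $\Omega$ is a semigroup, not necessarily commutative; $\mathbf{k}\Omega$ is its semigroup algebra (free $\mathbf{k}$-module on $\Omega$), and tensor products are over $\mathbf{k}$. All binary operations on $\mathbf{k}$-modules are $\mathbf{k}$-bilinear. A dendriform family algebra is a $\mathbf{k}$-module $D$ with binary operations $\{\prec_\omega,\succ_\omega\mid\omega\in\Omega\}$ such that for all $x,y,z\in D$ and $\alpha,\beta\in\Omega$: $(x\prec_\alpha y)\prec_\beta z=x\prec_{\alpha\beta}(y\prec_\beta z+y\succ_\alpha z)$; $(x\succ_\alpha y)\prec_\beta z=x\succ_\alpha(y\prec_\beta z)$; $(x\prec_\beta y+x\succ_\alpha y)\succ_{\alpha\beta}z=x\succ_\alpha(y\succ_\beta z)$. A tridendriform family algebra is a $\mathbf{k}$-module $T$ with binary operations $\{\prec_\omega,\succ_\omega\mid\omega\in\Omega\}$ and a binary operation $\cdot$ such that for all $x,y,z\in T$ and $\alpha,\beta\in\Omega$: $(x\prec_\alpha y)\prec_\beta z=x\prec_{\alpha\beta}(y\prec_\beta z+y\succ_\alpha z+y\cdot z)$; $(x\succ_\alpha y)\prec_\beta z=x\succ_\alpha(y\prec_\beta z)$; $(x\prec_\beta y+x\succ_\alpha y+x\cdot y)\succ_{\alpha\beta}z=x\succ_\alpha(y\succ_\beta z)$; $(x\succ_\alpha y)\cdot z=x\succ_\alpha(y\cdot z)$; $(x\prec_\alpha y)\cdot z=x\cdot(y\succ_\alpha z)$; $(x\cdot y)\prec_\alpha z=x\cdot(y\prec_\alpha z)$; $(x\cdot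 y)\cdot z=x\cdot(y\cdot z)$. A dendriform algebra is a $\mathbf{k}$-module $D$ with two binary operations $\prec,\succ$ such that for all $x,y,z$: $(x\prec y)\prec z=x\prec(y\prec z+y\succ z)$; $(x\succ y)\prec z=x\succ(y\prec z)$; $(x\prec y+x\succ y)\succ z=x\succ(y\succ z)$. A tridendriform algebra is a $\mathbf{k}$-module $T$ with three binary operations $\prec,\succ,\cdot$ such that for all $x,y,z$: $(x\prec y)\prec z=x\prec(y\prec z+y\succ z+y\cdot z)$; $(x\succ y)\prec z=x\succ(y\prec z)$; $(x\prec y+x\succ y+x\cdot y)\succ z=x\succ(y\succ z)$; $(x\succ y)\cdot z=x\succ(y\cdot z)$; $(x\prec y)\cdot z=x\cdot(y\succ z)$; $(x\cdot y)\prec z=x\cdot(y\prec z)$; $(x\cdot y)\cdot z=x\cdot(y\cdot z)$. *)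

(* Defs.v *)
From HB Require Import structures.
From mathcomp Require Import all_boot all_order all_algebra.
From mathcomp Require Import finmap boolp.
From mathcomp Require Import monalg.

Set Implicit Arguments.
Unset Strict Implicit.
Unset Printing Implicit Defensive.

Import GRing.Theory.
Local Open Scope ring_scope.
Local Open Scope quotient_scope.

(* The library's {bilinear _ -> _ -> _} is restricted to nzRingType; here the
   ground ring may be trivial, as in every structure below. *)
Definition bilinear_op (k : pzRingType) (U V W : lmodType k)
    (op : U -> V -> W) : Prop :=
  (forall v, linear (op^~ v)) /\ (forall u, linear (op u)).

(* Finitely supported functions K -> k. The underlying Z-module is that of
   {malg k[K]}, whose own scaling requires 0 != 1 in k. *)
Definition freemod (k : pzRingType) (K : choiceType) : Type := {malg k[K]}.

HB.instance Definition _ (k : pzRingType) (K : choiceType) :=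
  GRing.Zmodule.on (freemod k K).

Section FreeModule.
Context (k : pzRingType) (K : choiceType).
Implicit Types (g : freemod k K) (c : k).

Definition basis (a : K) : freemod k K := << 1 *g a >>.

Definition freemod_scale c g : freemod k K :=
  [malg a in msupp g => c * g@_a].

Lemma freemod_scaleE c g a : (freemod_scale c g)@_a = c * g@_a.
Proof. by rewrite mcoeffE; case: msuppP; rewrite ?mulr0. Qed.

Lemma freemod_scalerA c d g :
  freemod_scale c (freemod_scale d g) = freemod_scale (c * d) g.
Proof. by apply/malgP=> a; rewrite !freemod_scaleE mulrA. Qed.

Lemma freemod_scale1r : left_id 1 freemod_scale.
Proof. by move=> g; apply/malgP=> a; rewrite freemod_scaleE mul1r. Qed.

Lemma freemod_scalerDr : right_distributive freemod_scale +%R.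
Proof.
by move=> c g h; apply/malgP=> a; rewrite !(mcoeffD, freemod_scaleE) mulrDr.
Qed.

Lemma freemod_scalerDl g : {morph freemod_scale^~ g : c d / c + d}.
Proof.
by move=> c d; apply/malgP=> a; rewrite !(mcoeffD, freemod_scaleE) mulrDl.
Qed.

HB.instance Definition _ := GRing.Zmodule_isLmodule.Build k (freemod k K)
  freemod_scalerA freemod_scale1r freemod_scalerDr freemod_scalerDl.

Lemma freemodE g : g = \sum_(a <- msupp g) g@_a *: basis a.
Proof.
rewrite [LHS]monalgE; apply: eq_bigr => a _; apply/malgP=> b.
by rewrite freemod_scaleE !mcoeffU mulrnAr mulr1.
Qed.

Lemma freemod_ext (M : lmodType k) (f h : freemod k K -> M) :
  linear f -> linear h -> (forall a, f (basis a) = h (basis a)) -> f = h.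
Proof.
move=> lf lh fh; apply/funext => g; rewrite [g]freemodE.
pose F := HB.pack_for {linear freemod k K -> M} f
  (GRing.isLinear.Build _ _ _ _ f lf).
pose H := HB.pack_for {linear freemod k K -> M} h
  (GRing.isLinear.Build _ _ _ _ h lh).
rewrite -[LHS]/(F _) -[RHS]/(H _) !linear_sum; apply: eq_bigr => a _.
by rewrite !linearZ /= fh.
Qed.

Definition freemod_lift (M : lmodType k) (f : K -> M) (g : freemod k K) : M :=
  \sum_(a <- msupp g) g@_a *: f a.

Lemma freemod_liftEw (M : lmodType k) (f : K -> M) (g : freemod k K)
    (A : {fset K}) : (msupp g `<=` A)%fset ->
  freemod_lift f g = \sum_(a <- A) g@_a *: f a.
Proof.
move=> sA; rewrite /freemod_lift (big_fset_incl _ sA) // => a _ /mcoeff_outdom.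
by move=> ->; rewrite scale0r.
Qed.

Lemma freemod_lift_linear (M : lmodType k) (f : K -> M) :
  linear (freemod_lift f).
Proof.
move=> c g h; pose A := (msupp g `|` msupp h `|` msupp (c *: g + h)%R)%fset.
have sg : (msupp g `<=` A)%fset by apply/fsubsetP => x; rewrite !inE => ->.
have sh : (msupp h `<=` A)%fset.
  by apply/fsubsetP => x; rewrite !inE => ->; rewrite orbT.
have sgh : (msupp (c *: g + h)%R `<=` A)%fset.
  by apply/fsubsetP => x; rewrite !inE => ->; rewrite !orbT.
rewrite (freemod_liftEw _ sg) (freemod_liftEw _ sh) (freemod_liftEw _ sgh).
rewrite scaler_sumr -big_split /=; apply: eq_bigr => a _.
by rewrite mcoeffD freemod_scaleE scalerDl scalerA.
Qed.

Lemma freemod_lift_basis (M : lmodType k) (f : K -> M) a :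
  freemod_lift f (basis a) = f a.
Proof.
rewrite (freemod_liftEw _ (msuppU_le (k := a) (x := 1))) big_seq_fset1.
by rewrite mcoeffUU scale1r.
Qed.

End FreeModule.

Section Tensor.
Context (k : comPzRingType) (U V : lmodType k).

Local Notation free := (freemod k (U * V)%type).
Local Notation pair u v := (basis k (u, v)).

(* The submodule of the free module on U * V generated by the bilinearity
   relations. *)
Inductive tensor_rel : free -> Prop :=
| tensor_rel_l c u u' v :
    tensor_rel (pair (c *: u + u') v - (c *: pair u v + pair u' v))
| tensor_rel_r c u v v' :
    tensor_rel (pair u (c *: v + v') - (c *: pair u v + pair u v'))
| tensor_rel_0 : tensor_rel 0
| tensor_rel_lin c x y :
    tensor_rel x -> tensor_rel y -> tensor_rel (c *: x + y).

Definition tensor_relb : {pred free} := [pred x | `[< tensor_rel x >]].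

Lemma tensor_rel_scale c x : tensor_rel x -> tensor_rel (c *: x).
Proof.
by move=> rx; rewrite -[_ *: _]addr0; apply: tensor_rel_lin rx tensor_rel_0.
Qed.

Lemma tensor_relb_zmod_closed : zmod_closed tensor_relb.
Proof.
split=> [|x y /asboolP rx /asboolP ry]; first exact/asboolP/tensor_rel_0.
apply/asboolP; rewrite addrC -scaleN1r; exact: tensor_rel_lin.
Qed.

HB.instance Definition _ :=
  GRing.isZmodClosed.Build free tensor_relb tensor_relb_zmod_closed.

Local Notation quot := (Quotient.quot tensor_relb).

Definition tensor : Type := quot.

HB.instance Definition _ := GRing.Zmodule.on tensor.

Local Notation proj := (fun x : free => \pi_quot x : tensor).

Lemma tensor_projP x y : proj x = proj y <-> tensor_rel (x - y).
Proof.
have -> : tensor_rel (x - y) = (x - y \in tensor_relb) by rewrite inE asboolE.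
by rewrite Quotient.idealrBE; split => [->|/eqP].
Qed.

Lemma tensor_projD x y : proj (x + y) = proj x + proj y.
Proof. exact: (@pi_addr _ _ _ _ _ quot). Qed.

Definition tensor_scale (c : k) (t : tensor) : tensor :=
  proj (c *: repr (t : quot)).

Lemma tensor_projZ c x : proj (c *: x) = tensor_scale c (proj x).
Proof.
apply/tensor_projP; rewrite -scalerBr; apply: tensor_rel_scale.
by apply/tensor_projP; rewrite /= reprK.
Qed.

Lemma tensor_projW (P : tensor -> Prop) : (forall x, P (proj x)) -> forall t, P t.
Proof. by move=> Pp t; have := Pp (repr (t : quot)); rewrite reprK. Qed.

Lemma tensor_scalerA c d t :
  tensor_scale c (tensor_scale d t) = tensor_scale (c * d) t.
Proof. by elim/tensor_projW: t => x; rewrite -!tensor_projZ scalerA. Qed.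

Lemma tensor_scale1r : left_id 1 tensor_scale.
Proof. by elim/tensor_projW => x; rewrite -tensor_projZ scale1r. Qed.

Lemma tensor_scalerDr : right_distributive tensor_scale +%R.
Proof.
move=> c; elim/tensor_projW => x; elim/tensor_projW => y.
by rewrite -tensor_projD -!tensor_projZ scalerDr tensor_projD.
Qed.

Lemma tensor_scalerDl t : {morph tensor_scale^~ t : c d / c + d}.
Proof.
elim/tensor_projW: t => x c d.
by rewrite -!tensor_projZ scalerDl tensor_projD.
Qed.

HB.instance Definition _ := GRing.Zmodule_isLmodule.Build k tensor
  tensor_scalerA tensor_scale1r tensor_scalerDr tensor_scalerDl.

Definition tens (u : U) (v : V) : tensor := proj (pair u v).

Lemma tensor_proj_linear : linear proj.
Proof. by move=> c x y; rewrite tensor_projD tensor_projZ. Qed.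

Lemma tens_bilinear : bilinear_op tens.
Proof.
split=> [v c u u'|u c v v']; rewrite /tens -tensor_proj_linear.
  exact/tensor_projP/tensor_rel_l.
exact/tensor_projP/tensor_rel_r.
Qed.

Lemma tensor_ext (M : lmodType k) (f g : tensor -> M) :
  linear f -> linear g -> (forall u v, f (tens u v) = g (tens u v)) -> f = g.
Proof.
move=> lf lg fg; apply/funext; elim/tensor_projW => x.
rewrite -[LHS]/((f \o proj) x) -[RHS]/((g \o proj) x); move: x.
suff -> : f \o proj = g \o proj by [].
apply: freemod_ext => [c x y|c x y|[u v]]; last exact: fg.
  by rewrite /comp tensor_proj_linear lf.
by rewrite /comp tensor_proj_linear lg.
Qed.

Lemma tensor_universal (M : lmodType k) (f : U -> V -> M) :
  bilinear_op f -> exists! F : tensor -> M,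
    linear F /\ forall u v, F (tens u v) = f u v.
Proof.
move=> [fl fr]; pose G : free -> M := freemod_lift (fun p => f p.1 p.2).
have lG : linear G by exact: freemod_lift_linear.
pose GL := HB.pack_for {linear free -> M} G
  (GRing.isLinear.Build _ _ _ _ G lG).
have GE u v : GL (pair u v) = f u v by exact: freemod_lift_basis.
have G0 x : tensor_rel x -> GL x = 0.
  elim=> [c u u' v|c u v v'||c y z _ y0 _ z0].
  - by rewrite linearB linearP !GE fl subrr.
  - by rewrite linearB linearP !GE fr subrr.
  - exact: linear0.
  - by rewrite linearP y0 z0 scaler0 addr0.
pose F (t : tensor) : M := GL (repr (t : quot)).
have FE x : F (proj x) = GL x.
  apply/eqP; rewrite -subr_eq0 -linearB; apply/eqP/G0/tensor_projP.
  by rewrite /= reprK.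
have lF : linear F.
  move=> c; elim/tensor_projW => x; elim/tensor_projW => y.
  by rewrite -tensor_proj_linear !FE linearP.
have FT u v : F (tens u v) = f u v by rewrite FE GE.
exists F; split=> // F' [lF' F'T].
by apply: tensor_ext => // u v; rewrite FT F'T.
Qed.

End Tensor.

Notation "u \ox v" := (tens u v) (at level 40, left associativity).

Section Structures.
Context (k : comPzRingType).

Record dendriform_family (Omega : semigroupType) (D : lmodType k)
    (prec succ : Omega -> D -> D -> D) : Prop := DendriformFamily {
  df_prec_bilinear : forall a, bilinear_op (prec a);
  df_succ_bilinear : forall a, bilinear_op (succ a);
  df_prec_prec : forall x y z a b,
    prec b (prec a x y) z = prec (a * b)%g x (prec b y z + succ a y z);
  df_succ_prec : forall x y z a b,
    prec b (succ a x y) z = succ a x (prec b y z);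
  df_succ_succ : forall x y z a b,
    succ (a * b)%g (prec b x y + succ a x y) z = succ a x (succ b y z)
}.

Record tridendriform_family (Omega : semigroupType) (T : lmodType k)
    (prec succ : Omega -> T -> T -> T) (dot : T -> T -> T) : Prop :=
  TridendriformFamily {
  tf_prec_bilinear : forall a, bilinear_op (prec a);
  tf_succ_bilinear : forall a, bilinear_op (succ a);
  tf_dot_bilinear : bilinear_op dot;
  tf_prec_prec : forall x y z a b,
    prec b (prec a x y) z =
    prec (a * b)%g x (prec b y z + succ a y z + dot y z);
  tf_succ_prec : forall x y z a b,
    prec b (succ a x y) z = succ a x (prec b y z);
  tf_succ_succ : forall x y z a b,
    succ (a * b)%g (prec b x y + succ a x y + dot x y) z =
    succ a x (succ b y z);
  tf_succ_dot : forall x y z a, dot (succ a x y) z = succ a x (dot y z);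
  tf_prec_dot : forall x y z a, dot (prec a x y) z = dot x (succ a y z);
  tf_dot_prec : forall x y z a, prec a (dot x y) z = dot x (prec a y z);
  tf_dot_dot : forall x y z, dot (dot x y) z = dot x (dot y z)
}.

Record dendriform (D : lmodType k) (prec succ : D -> D -> D) : Prop :=
  Dendriform {
  d_prec_bilinear : bilinear_op prec;
  d_succ_bilinear : bilinear_op succ;
  d_prec_prec : forall x y z,
    prec (prec x y) z = prec x (prec y z + succ y z);
  d_succ_prec : forall x y z, prec (succ x y) z = succ x (prec y z);
  d_succ_succ : forall x y z,
    succ (prec x y + succ x y) z = succ x (succ y z)
}.

Record tridendriform (T : lmodType k) (prec succ dot : T -> T -> T) : Prop :=
  Tridendriform {
  t_prec_bilinear : bilinear_op prec;
  t_succ_bilinear : bilinear_op succ;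
  t_dot_bilinear : bilinear_op dot;
  t_prec_prec : forall x y z,
    prec (prec x y) z = prec x (prec y z + succ y z + dot y z);
  t_succ_prec : forall x y z, prec (succ x y) z = succ x (prec y z);
  t_succ_succ : forall x y z,
    succ (prec x y + succ x y + dot x y) z = succ x (succ y z);
  t_succ_dot : forall x y z, dot (succ x y) z = succ x (dot y z);
  t_prec_dot : forall x y z, dot (prec x y) z = dot x (succ y z);
  t_dot_prec : forall x y z, prec (dot x y) z = dot x (prec y z);
  t_dot_dot : forall x y z, dot (dot x y) z = dot x (dot y z)
}.

End Structures.

(* Main.v *)
Require Import Defs.
From mathcomp Require Import all_boot all_order all_algebra.
From mathcomp Require Import boolp.

Set Implicit Arguments.
Unset Strict Implicit.
Unset Printing Implicit Defensive.

Import GRing.Theory.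
Local Open Scope ring_scope.

(** Pure tensors [x \ox basis k a] generate [D \ox k Omega], and a family of
    linear maps on [D] indexed by [Omega] is the same as a linear map on this
    module; applied to each argument in turn this gives the operations and their
    uniqueness. Each axiom of a (tri)dendriform algebra has the shape
    [p (q x y) z = r x (s y z)], where [q] and [s] may be sums of operations;
    both sides are trilinear, so it suffices to check it on pure tensors, where
    it is an axiom of the family combined with associativity in [Omega]. *)

Lemma tensDl (k : comPzRingType) (U V : lmodType k) (u u' : U) (v : V) :
  (u + u') \ox v = u \ox v + u' \ox v.
Proof.
by have [/(_ v 1 u u') + _] := tens_bilinear U V; rewrite /= !scale1r.
Qed.

Lemma bilinear_op_add (k : pzRingType) (U V W : lmodType k)
    (p q : U -> V -> W) :
  bilinear_op p -> bilinear_op q -> bilinear_op (fun u v => p u v + q u v).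
Proof.
move=> [pl pr] [ql qr]; split=> [v c u u'|u c v v'] /=.
  by rewrite (pl v c) (ql v c) scalerDr addrACA.
by rewrite pr qr scalerDr addrACA.
Qed.

Section TensorFreemod.
Context (k : comPzRingType) (D : lmodType k) (K : choiceType).
Local Notation W := (tensor D (freemod k K)).

(** For fixed [x], both [f \o tens x] and [g \o tens x] are linear on the free module, so its basis
    decides. *)
Lemma tensor_freemod_ext (M : lmodType k) (f g : W -> M) :
    linear f -> linear g ->
    (forall x a, f (x \ox basis k a) = g (x \ox basis k a)) ->
  f = g.
Proof.
move=> lf lg fg; apply: tensor_ext => // x h.
have [_ /(_ x) lx] := tens_bilinear D (freemod k K).
rewrite -[LHS]/((f \o tens x) h) -[RHS]/((g \o tens x) h); move: h.
suff -> : f \o tens x = g \o tens x by [].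
apply: freemod_ext => [c h h'|c h h'|a]; last exact: fg.
  by rewrite /comp lx lf.
by rewrite /comp lx lg.
Qed.

(** Extend each [f x] linearly from the basis, then apply the universal property of the tensor
    product. *)
Lemma tensor_freemod_lift (M : lmodType k) (f : D -> K -> M) :
  (forall a, linear (f^~ a)) ->
  {F : W -> M | linear F & forall x a, F (x \ox basis k a) = f x a}.
Proof.
move=> lf; have bf : bilinear_op (fun x => freemod_lift (f x)).
  split=> [h c x x'|x]; last exact: freemod_lift_linear.
  (* The sum runs over the support of [h], which does not vary with [x], so linearity is checked
     termwise; [c] has to commute with the coefficient of [h]. *)
  rewrite /freemod_lift scaler_sumr -big_split; apply: eq_bigr => a _ /=.
  by rewrite (lf a) scalerDr !scalerA mulrC.
(* Choice makes [F] data, so that it can later be taken as a function of parameters. *)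
have [F [[lF FE] _]] := cid (tensor_universal bf).
by exists F => // x a; rewrite FE freemod_lift_basis.
Qed.

Lemma bilinear_op_tensor_ext (M : lmodType k) (p q : W -> W -> M) :
    bilinear_op p -> bilinear_op q ->
    (forall x y a b, p (x \ox basis k a) (y \ox basis k b) =
                     q (x \ox basis k a) (y \ox basis k b)) ->
  p = q.
Proof.
move=> [pl pr] [ql qr] pq; apply/funext => u.
apply: tensor_freemod_ext => [||y b]; [exact: pr | exact: qr |].
rewrite -[LHS]/((p^~ (y \ox basis k b)) u) -[RHS]/((q^~ (y \ox basis k b)) u).
by move: u; apply/funeqP/tensor_freemod_ext => [||x a]; [exact: pl | exact: ql |].
Qed.

(** One argument is lifted at a time: [F y b] extends the left one with [y] and [b] fixed, and [G u]
    extends the right one with [u] fixed. *)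
Lemma bilinear_op_tensor_lift (M : lmodType k) (f : K -> K -> D -> D -> M) :
    (forall a b, bilinear_op (f a b)) ->
  {op : W -> W -> M | bilinear_op op & forall x y a b,
    op (x \ox basis k a) (y \ox basis k b) = f a b x y}.
Proof.
move=> bf; have lF y b a : linear ((f a b)^~ y) by case: (bf a b).
pose F y b := s2val (tensor_freemod_lift (f := fun x a => f a b x y) (lF y b)).
have linF y b : linear (F y b) by rewrite /F; case: tensor_freemod_lift.
have FE x y a b : F y b (x \ox basis k a) = f a b x y.
  by rewrite /F; case: tensor_freemod_lift.
have lG u b : linear (fun y => F y b u).
  (* Both sides are linear in [u], the right one by commutativity of [k], so pure tensors suffice;
     there the claim is linearity of [f a b x]. *)
  move=> c y y'; rewrite -[RHS]/((fun u => c *: F y b u + F y' b u) u).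
  move: u; apply/funeqP/tensor_freemod_ext => [|e u u'|x a]; first exact: linF.
    rewrite !linF !scalerDr addrACA !scalerA; congr (_ + _).
    by rewrite mulrC.
  by rewrite !FE; case: (bf a b) => _ ->.
pose G u := s2val (tensor_freemod_lift (f := fun y b => F y b u) (lG u)).
have linG u : linear (G u) by rewrite /G; case: tensor_freemod_lift.
have GE u y b : G u (y \ox basis k b) = F y b u.
  by rewrite /G; case: tensor_freemod_lift.
exists G => [|x y a b]; last by rewrite GE FE.
split=> // v c u u'; rewrite -[RHS]/((fun v => c *: G u v + G u' v) v).
move: v; apply/funeqP/tensor_freemod_ext => [|e v v'|y b]; first exact: linG.
  by rewrite !linG !scalerDr addrACA !scalerA mulrC.
by rewrite !GE linF.
Qed.

Lemma bilinear_op_tensor_assoc (p q r s : W -> W -> W) :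
    bilinear_op p -> bilinear_op q -> bilinear_op r -> bilinear_op s ->
    (forall x y z a b c (X := x \ox basis k a) (Y := y \ox basis k b)
       (Z := z \ox basis k c), p (q X Y) Z = r X (s Y Z)) ->
  forall u v w, p (q u v) w = r u (s v w).
Proof.
move=> [pl pr] [ql qr] [rl rr] [sl sr] E u v w; move: w.
apply/funeqP/tensor_freemod_ext => [|e w w'|z c]; first exact: pr.
  by rewrite sr rr.
have bL : bilinear_op (fun u v => p (q u v) (z \ox basis k c)).
  split=> [{}v e u1 u2|{}u e v1 v2] /=.
    by rewrite (ql v e) (pl (z \ox basis k c) e).
  by rewrite qr (pl (z \ox basis k c) e).
have bR : bilinear_op (fun u v => r u (s v (z \ox basis k c))).
  split=> [{}v e u1 u2|{}u e v1 v2] /=; first by rewrite (rl (s _ _) e).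
  by rewrite (sl (z \ox basis k c) e) rr.
have := bilinear_op_tensor_ext bL bR (fun x y a b => E x y z a b c).
by move/(congr1 (fun h => h u v)).
Qed.

End TensorFreemod.

Section FamilyOp.
Context (k : comPzRingType) (Omega : semigroupType) (D : lmodType k).
Local Notation W := (tensor D (freemod k Omega)).
Implicit Types (f g : Omega -> Omega -> D -> D -> D) (op : W -> W -> W).

(** The indices of [f] are the labels of the two factors, which covers [prec] (right label), [succ]
    (left label), [dot] (constant) and their sums alike. *)
Definition family_op f op : Prop :=
  bilinear_op op /\ forall (x y : D) (a b : Omega),
    op (x \ox basis k a) (y \ox basis k b) = f a b x y \ox basis k (a * b)%g.

Lemma family_op_unique f :
  (forall a b, bilinear_op (f a b)) -> exists op, unique (family_op f) op.
Proof.
move=> bf; have [tl _] := tens_bilinear D (freemod k Omega).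
have [a b|op bop opE] := bilinear_op_tensor_lift
  (f := fun a b x y => f a b x y \ox basis k (a * b)%g).
  have [fl fr] := bf a b.
  split=> [y c x x'|x c y y'] /=; first by rewrite (fl y c) (tl _ c).
  by rewrite fr (tl _ c).
exists op; split=> // op' [bop' op'E].
by apply: bilinear_op_tensor_ext => // x y a b; rewrite opE op'E.
Qed.

Lemma family_op_add f g op op' : family_op f op -> family_op g op' ->
  family_op (fun a b x y => f a b x y + g a b x y)
            (fun u v => op u v + op' u v).
Proof.
move=> [bop opE] [bop' op'E]; split; first exact: bilinear_op_add.
by move=> x y a b; rewrite opE op'E tensDl.
Qed.

(** For labels [a], [b], [c], the product [q X Y] carries label [a * b] and [s Y Z] carries [b * c],
    whence the indices of [fp] and [fr]. *)
Lemma family_op_assoc fp fq fr fs (p q r s : W -> W -> W) :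
    family_op fp p -> family_op fq q -> family_op fr r -> family_op fs s ->
    (forall x y z a b c,
      fp (a * b)%g c (fq a b x y) z = fr a (b * c)%g x (fs b c y z)) ->
  forall u v w, p (q u v) w = r u (s v w).
Proof.
move=> [bp pE] [bq qE] [br rE] [bs sE] E.
apply: bilinear_op_tensor_assoc => // x y z a b c /=.
by rewrite qE pE sE rE E mulgA.
Qed.

End FamilyOp.

Theorem theorem2p11 (k : comPzRingType) (Omega : semigroupType) :
  (forall (D : lmodType k) (prec succ : Omega -> D -> D -> D),
    dendriform_family prec succ ->
    exists Prec Succ : tensor D (freemod k Omega) ->
        tensor D (freemod k Omega) -> tensor D (freemod k Omega),
    [/\ unique (fun op => bilinear_op op /\ forall (x y : D) (a b : Omega),
          op (x \ox basis k a) (y \ox basis k b) =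
          prec b x y \ox basis k (a * b)%g) Prec,
        unique (fun op => bilinear_op op /\ forall (x y : D) (a b : Omega),
          op (x \ox basis k a) (y \ox basis k b) =
          succ a x y \ox basis k (a * b)%g) Succ &
        dendriform Prec Succ]) /\
  (forall (T : lmodType k) (prec succ : Omega -> T -> T -> T)
      (dot : T -> T -> T),
    tridendriform_family prec succ dot ->
    exists Prec Succ Bullet : tensor T (freemod k Omega) ->
        tensor T (freemod k Omega) -> tensor T (freemod k Omega),
    [/\ unique (fun op => bilinear_op op /\ forall (x y : T) (a b : Omega),
          op (x \ox basis k a) (y \ox basis k b) =
          prec b x y \ox basis k (a * b)%g) Prec,
        unique (fun op => bilinear_op op /\ forall (x y : T) (a b : Omega),
          op (x \ox basis k a) (y \ox basis k b) =
          succ a x y \ox basis k (a * b)%g) Succ,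
        unique (fun op => bilinear_op op /\ forall (x y : T) (a b : Omega),
          op (x \ox basis k a) (y \ox basis k b) =
          dot x y \ox basis k (a * b)%g) Bullet &
        tridendriform Prec Succ Bullet]).
Proof.
split=> [D prec succ F|T prec succ dot F].
  have [Prec uP] := family_op_unique (f := fun _ b => prec b)
    (fun _ => df_prec_bilinear F).
  have [Succ uS] := family_op_unique (f := fun a _ => succ a)
    (fun a _ => df_succ_bilinear F a).
  exists Prec, Succ; split; [exact: uP | exact: uS |].
  have [[fP _] [fS _]] := (uP, uS).
  have fPS := family_op_add fP fS.
  split; [exact: fP.1 | exact: fS.1 | | |].
  (* On factors labelled [a], [b], [c], the three axioms become those of the family at [(b, c)],
     [(a, c)] and [(a, b)]. *)
  - by apply: (family_op_assoc fP fP fP fPS) => *; apply: (df_prec_prec F).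
  - by apply: (family_op_assoc fP fS fS fP) => *; apply: (df_succ_prec F).
  - by apply: (family_op_assoc fS fPS fS fS) => *; apply: (df_succ_succ F).
have [Prec uP] := family_op_unique (f := fun _ b => prec b)
  (fun _ => tf_prec_bilinear F).
have [Succ uS] := family_op_unique (f := fun a _ => succ a)
  (fun a _ => tf_succ_bilinear F a).
have [Bullet uB] := family_op_unique (f := fun _ _ : Omega => dot)
  (fun _ _ => tf_dot_bilinear F).
exists Prec, Succ, Bullet; split; [exact: uP | exact: uS | exact: uB |].
have [[[fP _] [fS _]] [fB _]] := (uP, uS, uB).
have fPSB := family_op_add (family_op_add fP fS) fB.
split; [exact: fP.1 | exact: fS.1 | exact: fB.1 | | | | | | |].
- by apply: (family_op_assoc fP fP fP fPSB) => *; apply: (tf_prec_prec F).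
- by apply: (family_op_assoc fP fS fS fP) => *; apply: (tf_succ_prec F).
- by apply: (family_op_assoc fS fPSB fS fS) => *; apply: (tf_succ_succ F).
(* The next three axioms are those of the family at the single index [a], [b] and [c]
   respectively. *)
- by apply: (family_op_assoc fB fS fS fB) => *; apply: (tf_succ_dot F).
- by apply: (family_op_assoc fB fP fB fS) => *; apply: (tf_prec_dot F).
- by apply: (family_op_assoc fP fB fB fP) => *; apply: (tf_dot_prec F).
- by apply: (family_op_assoc fB fB fB fB) => *; apply: (tf_dot_dot F).
Qed.
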